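(* A topological group is isomorphic (as a topological group) to the real line endowed with the Bohr topology if and only if it is one-parametric, totally bounded, $\mathbb{N}$-scaled and not monothetic.
   Context: All topological groups are assumed to be Hausdorff; $\mathbb{N}$ is the set of positive integers; groups are written additively. Two topological groups are isomorphic if there is a group isomorphism between them that is also a homeomorphism. The Bohr topology on the real line is the smallest topology on $\mathbb{R}$ in which every homomorphism $\mathbb{R}\to\mathbb{T}=\{z\in\mathbb{C}:|z|=1\}$ that is continuous with respect to the Euclidean topology (equivalently, every $\chi_t:x\mapsto e^{2\pi i t x}$, $t\in\mathbb{R}$) is continuous. A topological group $G$ is one-parametric if there exists a surjective continuous group homomorphism $\phi:\mathbb{R}\to G$, where $\mathbb{R}$ carries the Euclidean topology. It is totally bounded if for every open neighborhood $U$ of $0$ there is a finite set $F\subseteq G$ with $G=\bigcup_{x\in F}(x+U)$. It is $\mathbb{N}$-scaled if for every $n\in\mathbb{N}$ the map $G\to G$, $x\mapsto n\cdot x$, is open. It is monothetic if there exists $g\in G$ such that the cyclic subgroup $\{ng:n\in\mathbb{Z}\}$ is dense in $G$. *)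

(* Defs.v *)
From HB Require Import structures.
From mathcomp Require Import all_boot all_order all_algebra.
From mathcomp Require Import complex.
From mathcomp Require Import all_classical all_reals all_analysis.

Set Implicit Arguments.
Unset Strict Implicit.
Unset Printing Implicit Defensive.

Import Order.TTheory GRing.Theory Num.Theory.
Import numFieldNormedType.Exports.

Local Open Scope classical_set_scope.
Local Open Scope ring_scope.
Local Open Scope complex_scope.

(* Topological groups are not assumed commutative. MathComp has no additive
   notation for such groups, so the group law is written multiplicatively
   (groupType); the additive group bohr R is viewed as one through
   to_multiplicative. *)
HB.mixin Record isTopologicalGroup G & Topological G & Group G := {
  mulg_continuous : continuous (fun x : G * G => (x.1 * x.2)%g) ;
  invg_continuous : continuous (fun x : G => (x^-1)%g) ;
}.

#[short(type="topologicalGroupType")]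
HB.structure Definition TopologicalGroup :=
  {G of Topological G & Group G & isTopologicalGroup G}.

HB.instance Definition _ (V : topologicalType) :=
  Topological.copy (Algebra.to_multiplicative V) V.

HB.instance Definition _ (V : topologicalZmodType) :=
  isTopologicalGroup.Build (Algebra.to_multiplicative V)
    (@add_continuous V) (@opp_continuous V).

Definition topgroup_isomorphic (G H : topologicalGroupType) : Prop :=
  exists f : G -> H, exists g : H -> G,
    [/\ {morph f : x y / (x * y)%g >-> (x * y)%g}, cancel f g, cancel g f,
        continuous f & continuous g].

Section BohrTopology.
Variable R : realType.

(* A continuous homomorphism from the Euclidean line to the unit circle is
   encoded as a function to the complex numbers with values of modulus 1; the
   circle has the subspace topology, so both its continuity and the initial
   topology it induces on R are unaffected. R[i]^o is R[i] with the topology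
   given by the modulus. *)
Definition is_character (chi : R -> R[i]^o) : Prop :=
  [/\ {morph chi : x y / x + y >-> x * y}, forall x, `|chi x| = 1
    & continuous chi].

Definition bohr_family (chi : {chi : R -> R[i]^o | is_character chi}) :
    Topological R :=
  Topological.class (initial_topology (sval chi)).

(* The supremum of the initial topologies of the characters, i.e. the smallest
   topology on R in which every character is continuous. *)
Definition bohr : Type := sup_topology bohr_family.

HB.instance Definition _ := Topological.copy bohr (sup_topology bohr_family).
HB.instance Definition _ := GRing.Zmodule.copy bohr R.

Lemma bohr_character_continuous (chi : R -> R[i]^o) :
  is_character chi -> continuous (chi : bohr -> R[i]^o).
Proof.
move=> hchi x; have /cvg_sup /(_ (exist _ chi hchi)) cx : nbhs (x : bohr) --> x by [].
apply: cvg_trans (@initial_continuous R R[i]^o chi x).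
by move=> A /= /cx.
Qed.

Lemma cvg_bohr (F : set_system R) (x : bohr) : Filter F ->
  (forall chi : R -> R[i]^o, is_character chi -> chi @ F --> chi x) ->
  F --> x.
Proof.
move=> FF Fchi; apply/cvg_sup => -[chi hchi] A /=.
rewrite (@nbhsE (initial_topology chi)) => -[_ [[B oB <-] Bx] sBA].
apply: filterS sBA _; apply: (Fchi chi hchi).
exact: open_nbhs_nbhs.
Qed.

Lemma bohr_add_continuous : continuous (fun x : bohr * bohr => x.1 + x.2).
Proof.
move=> x; apply: cvg_bohr => chi hchi; have [chiD _ _] := hchi.
have chic := bohr_character_continuous hchi.
have -> : chi (x.1 + x.2) = chi x.1 * chi x.2 by exact: chiD.
have : (fun y : bohr * bohr => chi y.1 * chi y.2) @ x --> chi x.1 * chi x.2.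
  apply: (@cvgM R[i] _ (nbhs x) _ (chi \o fst) (chi \o snd)).
    apply: (@continuous_comp _ bohr _ fst chi x); last exact: chic.
    exact: cvg_fst.
  apply: (@continuous_comp _ bohr _ snd chi x); last exact: chic.
  exact: cvg_snd.
apply: cvg_trans; rewrite (_ : (fun y : bohr * bohr => chi y.1 * chi y.2) =
  chi \o (fun y : bohr * bohr => y.1 + y.2)) //.
by apply/funext => y /=; rewrite -chiD.
Qed.

Lemma bohr_opp_continuous : continuous (-%R : bohr -> bohr).
Proof.
move=> x; have FF : Filter ((-%R : bohr -> bohr) @ x).
  exact: (fmap_filter _ (nbhs_filter (x : bohr))).
apply: cvg_bohr => chi hchi; have [chiD chi1 _] := hchi.
have chi_neq0 y : chi y != 0 by rewrite -normr_gt0 chi1.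
have chi0 : chi 0 = 1.
  by apply: (mulfI (chi_neq0 0)); rewrite mulr1 -chiD addr0.
have chiN y : chi (- y) = (chi y)^-1.
  by apply: (mulfI (chi_neq0 y)); rewrite -chiD subrr chi0 divff.
have chic := bohr_character_continuous hchi.
have -> : chi (- x) = (chi x)^-1 by exact: chiN.
have : (fun y : bohr => (chi y)^-1) @ x --> (chi x)^-1.
  exact: (@cvgV R[i] _ (nbhs x) _ chi _ (chi_neq0 x) (chic x)).
apply: cvg_trans; rewrite (_ : (fun y : bohr => (chi y)^-1) =
  chi \o (fun y : bohr => - y)) //.
by apply/funext => y /=; rewrite -chiN.
Qed.

HB.instance Definition _ :=
  PreTopologicalNmodule_isTopologicalNmodule.Build bohr bohr_add_continuous.
HB.instance Definition _ :=
  TopologicalNmodule_isTopologicalZmodule.Build bohr bohr_opp_continuous.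

End BohrTopology.

Definition one_parametric (R : realType) (G : topologicalGroupType) : Prop :=
  exists phi : R -> G,
    [/\ {morph phi : x y / x + y >-> (x * y)%g}, continuous phi
      & forall g : G, exists x : R, phi x = g].

Definition totally_bounded (G : topologicalGroupType) : Prop :=
  forall U : set G, open U -> U 1%g ->
    exists2 F : set G, finite_set F &
      \bigcup_(x in F) [set (x * u)%g | u in U] = setT.

Definition nat_scaled (G : topologicalGroupType) : Prop :=
  forall n : nat, (0 < n)%N ->
    forall U : set G, open U -> open [set (x ^+ n)%g | x in U].

Definition cyclic_subgroup (G : groupType) (g : G) : set G :=
  [set h | exists n : nat, h = (g ^+ n)%g \/ h = (g ^- n)%g].

Definition monothetic (G : topologicalGroupType) : Prop :=
  exists g : G, dense (cyclic_subgroup g).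

(* Main.v *)
Require Import Defs.
From mathcomp Require Import all_boot all_order all_algebra.
From mathcomp Require Import complex ring lra zify.
From mathcomp Require Import all_classical all_reals all_analysis.

(**
The Bohr topology of the line has a simple description: every continuous
character chi of R takes the value 1 at some rho > 0 (character_period), so it
factors through a circle R / rho Z, and the sets
  near_multiple rho d = {x | x is within d of a multiple of rho}
form a subbase at 0 (cvg_bohr0, near_multiple_bohr). The line with this topology
is a continuous image of the Euclidean line; it is totally bounded because each
circle is; division by n permutes the subbase, so multiplication by n is open; and
the multiples of g stay away from g / 2 modulo g, so that g is not a generator.

Conversely, let phi : R -> G be a continuous surjective homomorphism. Two
inclusions between the topology of G, pulled back to R, and the Bohr topology are
needed.

The Bohr topology is coarser. For rho > 0 the closure of the subgroup generated by
phi rho is not G, since G is not monothetic; its preimage is a closed proper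
subgroup of R containing rho, hence of the form (rho / m) Z. A compactness
argument then shows that the map from G to the circle R / (rho / m) Z is well
defined and continuous (near_submultiple). Taking for rho an irrational multiple
of a hypothetical element of the kernel of phi, one sees that phi is injective
(phi_injective). As multiplication by m is open on G, the denominator m can be
removed (near_multiple_phi), which gives all of the subbase.

The Bohr topology is finer. This is where total boundedness enters, through the
theorem of Bogolyubov and Folner on Z: when finitely many translates of A cover Z,
the set (A - A) + (A - A) contains a Bohr neighbourhood of 0 (bogolyubov_folner).
It follows by compactness from a computation with finite Fourier sums modulo M in
which the number of frequencies does not depend on M (bogolyubov_finite). Applied
to the times n at which phi (n * rho) lies in a small neighbourhood of 1, for a
small step rho, it gives the inclusion on rho Z, and the continuity of phi extends
it to R (bohr_nbhs_phi).
*)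

Set Implicit Arguments.
Unset Strict Implicit.
Unset Printing Implicit Defensive.

Import Order.TTheory GRing.Theory Num.Theory.
Import numFieldNormedType.Exports.

Local Open Scope classical_set_scope.
Local Open Scope ring_scope.

(** * Cosine and sine of an angle measured in turns *)

Section Turns.
Variable R : realType.
Implicit Types (x y h : R) (n : int) (I : finType).

(** Angles are counted in full turns, so that the integers are the periods and
    the characters of Z/M are r |-> ucos (j * r / M) + i usin (j * r / M). *)
Definition ucos x : R := cos (x * (pi *+ 2)).
Definition usin x : R := sin (x * (pi *+ 2)).

Lemma ucos0 : ucos 0 = 1. Proof. by rewrite /ucos mul0r cos0. Qed.
Lemma usin0 : usin 0 = 0. Proof. by rewrite /usin mul0r sin0. Qed.
Lemma ucosN x : ucos (- x) = ucos x. Proof. by rewrite /ucos mulNr cosN. Qed.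
Lemma usinN x : usin (- x) = - usin x. Proof. by rewrite /usin mulNr sinN. Qed.
Lemma ucosD x y : ucos (x + y) = ucos x * ucos y - usin x * usin y.
Proof. by rewrite /ucos mulrDl cosD. Qed.
Lemma usinD x y : usin (x + y) = usin x * ucos y + ucos x * usin y.
Proof. by rewrite /usin mulrDl sinD. Qed.
Lemma ucos2Dusin2 x : ucos x ^+ 2 + usin x ^+ 2 = 1.
Proof. exact: cos2Dsin2. Qed.

Lemma continuous_ucos : continuous ucos.
Proof.
move=> x; apply: (@continuous_comp R R R ( *%R^~ (pi *+ 2)) cos x).
  exact: mulrr_continuous.
exact: continuous_cos.
Qed.

Lemma continuous_usin : continuous usin.
Proof.
move=> x; apply: (@continuous_comp R R R ( *%R^~ (pi *+ 2)) sin x).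
  exact: mulrr_continuous.
exact: continuous_sin.
Qed.

Lemma ucos_usin_nat (k : nat) : ucos k%:R = 1 /\ usin k%:R = 0.
Proof.
elim: k => [|k [IHc IHs]]; first by rewrite ucos0 usin0.
have c1 : ucos 1 = 1 by rewrite /ucos mul1r cos2pi.
have s1 : usin 1 = 0 by rewrite /usin mul1r sin2pi.
by rewrite -addn1 natrD ucosD usinD IHc IHs c1 s1 !mulr1 !mulr0 subr0 addr0.
Qed.

Lemma ucos_usin_int n : ucos n%:~R = 1 /\ usin n%:~R = 0.
Proof.
case: n => k; first exact: ucos_usin_nat.
have [ck sk] := ucos_usin_nat k.+1.
by rewrite NegzE rmorphN /= ucosN usinN ck sk oppr0.
Qed.

Lemma ucosDz x n : ucos (x + n%:~R) = ucos x.
Proof. by have [cn sn] := ucos_usin_int n; rewrite ucosD cn sn; ring. Qed.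

Lemma usinDz x n : usin (x + n%:~R) = usin x.
Proof. by have [cn sn] := ucos_usin_int n; rewrite usinD cn sn; ring. Qed.

Lemma ucos_gt0 x n : `|x - n%:~R| < 1 / 4 -> 0 < ucos x.
Proof.
rewrite -[X in ucos X](subrK n%:~R x) ucosDz; set y := x - _.
rewrite ltr_norml => /andP[y0 y1]; apply: cos_gt0_pihalf.
by have pi0 := pi_gt0 R; apply/andP; split; nra.
Qed.

(** The shifted floor moves x into [-1/2, 1/2], where the cosine decreases
    with the distance to 0; so a large cosine forces x close to an integer. *)
Lemma near_int_ucos (d x : R) : 0 <= d <= 1 / 2 -> ucos d < ucos x ->
  exists n : int, `|x - n%:~R| < d.
Proof.
move=> /andP[d0 d1] dx; exists (Num.floor (x + 1 / 2)).
set n := Num.floor _; set y := x - n%:~R.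
have ypi : `|y| <= 1 / 2.
  have := floor_itv (x + 1 / 2); rewrite -/n => /andP[h1 h2].
  rewrite intrD in h2; rewrite ler_norml /y; apply/andP; split; lra.
have uxy : ucos x = ucos `|y|.
  rewrite -[in LHS](subrK n%:~R x) ucosDz -/y.
  by have [_|_] := ger0P y; rewrite ?ucosN.
move: dx; rewrite uxy /ucos.
have pi0 := pi_gt0 R.
have in_pi z : 0 <= z <= 1 / 2 -> z * (pi *+ 2) \in `[0, (pi : R)].
  move=> /andP[z0 z1]; rewrite in_itv /=; apply/andP; split; nra.
rewrite ltr_cos ?in_pi ?d0 ?normr_ge0 //.
by rewrite ltr_pM2r // mulrn_wgt0.
Qed.

Lemma ucos_eq1 x : ucos x = 1 -> exists n : int, x = n%:~R.
Proof.
move=> x1.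
pose n := Num.floor (x + 1 / 2); exists n.
have [//|xn] := eqVneq x n%:~R.
have := floor_itv (x + 1 / 2); rewrite -/n => /andP[h1 h2].
rewrite intrD in h2.
pose d := Num.min `|x - n%:~R| (1/2).
have d0 : 0 < d by rewrite /d lt_min normr_gt0 subr_eq0 xn; lra.
have d1 : d <= 1 / 2 by rewrite /d ge_min lexx orbT.
have pi0 := pi_gt0 R.
have cd : ucos d < ucos x.
  rewrite x1 -ucos0 /ucos ltr_cos ?in_itv /= ?mul0r ?lexx ?pi_ge0 //.
    by rewrite mulr_gt0 // mulrn_wgt0.
  apply/andP; split; nra.
suff : `|x - n%:~R| < `|x - n%:~R| by rewrite ltxx.
have xd : `|x - n%:~R| = d.
  by apply/esym/min_idPl; rewrite ler_norml; apply/andP; split; lra.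
rewrite {2}xd.
have [m hm] : exists m : int, `|x - m%:~R| < d.
  by apply: near_int_ucos => //; rewrite (ltW d0).
suff -> : n = m by [].
apply/eqP; rewrite eq_le -!ltzD1; move: hm; rewrite ltr_norml => /andP[m1 m2].
by rewrite -!(ltr_int R) !intrD; apply/andP; split; lra.
Qed.

(** Orthogonality of the characters of Z/M. When M does not divide j,
    multiplying the sum by 2 sin (pi j / M), which is nonzero, makes it
    telescope. *)
Lemma sum_ucos (M : nat) (j : int) : (0 < M)%N ->
  \sum_(r < M) ucos (j%:~R * r%:R / M%:R) = if (M %| j)%Z then M%:R else 0.
Proof.
move=> M0; have M0' : (M%:R : R) != 0 by rewrite pnatr_eq0 -lt0n.
case: ifP => [/dvdzP[q ->]|ndvd].
  under eq_bigr => r _.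
    rewrite (_ : _ / _ = (q * r)%:~R); last first.
      by rewrite !rmorphM /= -!pmulrn; field.
    rewrite (ucos_usin_int _).1; over.
  by rewrite sumr_const card_ord.
pose u : R := j%:~R / M%:R; pose h := u / 2.
have uh : u = h + h by rewrite /h; field.
have s0 : usin h != 0.
  apply: contraFneq ndvd => s0.
  have /ucos_eq1[n un] : ucos u = 1.
    by rewrite uh ucosD s0 mulr0 subr0 -[RHS](ucos2Dusin2 h) s0; ring.
  have : (j%:~R : R) = (n * M)%:~R.
    by rewrite rmorphM /= -un -pmulrn /u divfK.
  by move=> /intr_inj ->; exact: dvdz_mull.
have tele (m : nat) :
    2 * usin h * \sum_(r < m) ucos (r%:R * u) = usin (m%:R * u - h) + usin h.
  elim: m => [|m IHm].
    by rewrite big_ord0 mulr0 mul0r add0r usinN addNr.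
  rewrite big_ord_recr /= mulrDr IHm.
  rewrite (_ : m.+1%:R * u - h = m%:R * u + h); last first.
    by rewrite -natr1 mulrDl mul1r {2}uh; ring.
  by rewrite !usinD ucosN usinN; ring.
have /eqP : 2 * usin h * \sum_(r < M) ucos (r%:R * u) = 0.
  rewrite tele addrC (_ : M%:R * u = j%:~R); last by rewrite /u mulrC divfK.
  by rewrite addrC (addrC _ (- h)) usinDz usinN addNr.
rewrite !mulf_eq0 (negbTE s0) pnatr_eq0 /= => /eqP sum0.
rewrite -[RHS]sum0; apply: eq_bigr => r _; congr ucos; rewrite /u; ring.
Qed.

(** This is the squared modulus of an exponential sum; written as a double sum
    of cosines it stays real. *)
Lemma sum_ucosB I (f : I -> R) :
  \sum_a \sum_b ucos (f a - f b) =
  (\sum_a ucos (f a)) ^+ 2 + (\sum_a usin (f a)) ^+ 2.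
Proof.
rewrite !expr2 !mulr_suml -big_split /=; apply: eq_bigr => a _.
rewrite !mulr_sumr -big_split /=; apply: eq_bigr => b _.
by rewrite ucosD ucosN usinN; ring.
Qed.

Lemma sum_ucosB_ge0 I (f : I -> R) : 0 <= \sum_a \sum_b ucos (f a - f b).
Proof. by rewrite sum_ucosB addr_ge0 ?sqr_ge0. Qed.

(** The differences f a - f b are symmetric about 0, so their sines cancel and
    a phase y comes out as a factor. Used twice, it turns the square of a
    power spectrum into a sum over quadruples. *)
Lemma sum_ucosDB I (f : I -> R) y :
  \sum_a \sum_b ucos (y + (f a - f b)) =
  ucos y * \sum_a \sum_b ucos (f a - f b).
Proof.
have sin0 : \sum_a \sum_b usin (f a - f b) = 0.
  have H : \sum_a \sum_b usin (f a - f b) = - \sum_a \sum_b usin (f a - f b).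
    rewrite {1}exchange_big /= -sumrN; apply: eq_bigr => a _.
    by rewrite -sumrN; apply: eq_bigr => b _; rewrite -usinN opprB.
  lra.
transitivity (ucos y * (\sum_a \sum_b ucos (f a - f b))
              - usin y * \sum_a \sum_b usin (f a - f b)); last first.
  by rewrite sin0 mulr0 subr0.
rewrite !mulr_sumr -sumrB; apply: eq_bigr => a _.
by rewrite !mulr_sumr -sumrB; apply: eq_bigr => b _; rewrite ucosD.
Qed.

End Turns.

(** * The Bogolyubov-Folner theorem on the integers *)

Section Bogolyubov.
Variable R : realType.

(** Bogolyubov's argument in Z/M with M = 3N, large enough for sums of four
    entries of v and one x to be determined by their residue. With p the power
    spectrum of v, the sum of p r ^+ 2 * ucos (x * r / M) over r is M times the
    number of quadruples with x + (v a - v b) + (v c - v d) = 0 mod M. If there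
    are none, the sum is zero; yet the term r = 0 contributes #|I| ^ 4, the terms
    with p r above the threshold T are nonnegative by the hypothesis on x, and
    the others amount to at most T * \sum_r p r, which is smaller. The number
    of frequencies with T <= p r is bounded independently of N, again through
    \sum_r p r; this uniformity is what allows N to tend to infinity later. *)
Lemma bogolyubov_finite (I : finType) (v : I -> int) (N f : nat) :
    (0 < N)%N -> (N <= f * #|I|)%N -> injective v ->
    (forall i, 0 <= v i < N%:Z) ->
  exists theta : 'I_(10 * f ^ 2) -> R, (forall i, 0 <= theta i <= 1) /\
    forall x : int, `|x| <= N%:Z ->
      (forall i, 0 <= ucos (x%:~R * theta i)) ->
      exists a b c d, x = (v a - v b) + (v c - v d).
Proof.
move=> N0 NfI vI vN; pose M := (3 * N)%N.
have M0 : (0 < M)%N by rewrite muln_gt0.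
pose m : R := #|I|%:R.
have I0 : (0 < #|I|)%N by move: (leq_trans N0 NfI); rewrite muln_gt0 => /andP[].
have f0 : (0 < f)%N by move: (leq_trans N0 NfI); rewrite muln_gt0 => /andP[].
have m0 : 0 < m by rewrite ltr0n.
have fR0 : 0 < (f%:R : R) by rewrite ltr0n.
have MR0 : 0 < (M%:R : R) by rewrite ltr0n.
have Mfm : M%:R <= 3 * f%:R * m.
  by rewrite /M natrM -mulrA ler_pM2l // -natrM ler_nat.
pose w (r : 'I_M) a : R := (v a)%:~R * r%:R / M%:R.
pose p r := \sum_a \sum_b ucos (w r a - w r b).
have p_ge0 r : 0 <= p r by exact: sum_ucosB_ge0.
have small (z : int) : (M %| z)%Z -> `|z| < M%:Z -> z = 0.
  have M0' : 0 < M%:Z by [].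
  move=> /dvdzP[q ->]; rewrite normrM (gtr0_norm M0') => qM.
  suff /eqP -> : q == 0 by rewrite mul0r.
  have : `|q| < 1 by nia.
  lia.
have sum_p : \sum_r p r = M%:R * m.
  transitivity (\sum_(a : I) \sum_(b : I) \sum_(r < M)
      (ucos ((v a - v b)%:~R * r%:R / M%:R) : R)).
    rewrite exchange_big /=; apply: eq_bigr => a _.
    rewrite exchange_big /=; apply: eq_bigr => b _.
    by apply: eq_bigr => r _; congr ucos; rewrite /w intrB; ring.
  rewrite /m mulr_natr -sumr_const; apply: eq_bigr => a _.
  rewrite (bigD1 a) //= [X in _ + X]big1 ?addr0 => [|b ba].
    by rewrite sum_ucos // subrr dvdz0.
  rewrite sum_ucos //; case: ifP => // /small vab.
  case/eqP: ba; apply: vI; apply/esym/eqP; rewrite -subr_eq0 vab //.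
  by have := vN a; have := vN b; rewrite /M; lia.
(* T is a fixed fraction of \sum_r p r, so at most 10 f^2 values exceed it; it is
   small enough since M <= 3 f #|I| gives M^2 <= 9 f^2 #|I|^2 < 10 f^2 #|I|^2. *)
pose T := M%:R * m / (10 * f%:R ^+ 2).
have T0 : 0 < T by rewrite divr_gt0 ?mulr_gt0 ?exprn_gt0.
pose spec := [seq r <- enum 'I_M | T <= p r].
have size_spec : (size spec <= 10 * f ^ 2)%N.
  have : (size spec)%:R * T <= M%:R * m.
    rewrite -sum_p -[X in _ <= X]big_enum /=.
    rewrite (bigID (fun r => T <= p r)) /= -(big_filter _ (fun r => T <= p r)).
    rewrite -/spec ler_wpDr ?sumr_ge0 //.
    have : all (fun r => T <= p r) spec.
      by apply/allP => r; rewrite mem_filter => /andP[].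
    elim: (spec) => [_|r s IHs] /=; first by rewrite mul0r big_nil.
    move=> /andP[rT /IHs sT]; rewrite big_cons -natr1 mulrDl mul1r addrC.
    exact: lerD.
  have MT : M%:R * m = (10 * f ^ 2)%:R * T.
    by rewrite /T natrM natrX; field; rewrite gt_eqF.
  by rewrite MT ler_pM2r // ler_nat.
(* Unused slots hold the frequency 0, for which the condition on x is void. *)
exists (fun i => nth 0 [seq (r : 'I_M)%:R / M%:R | r <- spec] i); split.
  move=> i; have [si|si] := ltnP i (size spec); last first.
    by rewrite nth_default ?size_map // lexx ler01.
  have r0 : 'I_M by exact: Ordinal M0.
  rewrite (nth_map r0) //; apply/andP; split; first by rewrite divr_ge0.
  by rewrite ler_pdivrMr // mul1r ler_nat ltnW.
move=> x xN xtheta; apply: contrapT => nox.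
have spec_ge0 r : T <= p r -> 0 <= ucos (x%:~R * r%:R / M%:R : R).
  move=> rT; have rs : r \in spec by rewrite mem_filter rT mem_enum.
  have si : (index r spec < 10 * f ^ 2)%N.
    by rewrite (leq_trans _ size_spec) ?index_mem.
  have := xtheta (Ordinal si).
  by rewrite /= (nth_map r) ?index_mem // nth_index // mulrA.
have sum0 : \sum_(r < M) p r ^+ 2 * ucos (x%:~R * r%:R / M%:R) = 0.
  transitivity (\sum_(r < M) \sum_(a : I) \sum_(b : I) \sum_(c : I) \sum_(d : I)
      ucos ((x + (v a - v b) + (v c - v d))%:~R * r%:R / M%:R : R)).
    apply: eq_bigr => r _.
    rewrite expr2 -mulrA [p r * ucos _]mulrC mulrA mulrC.
    rewrite [p r * ucos _]mulrC {2}/p -sum_ucosDB mulr_sumr.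
    apply: eq_bigr => a _; rewrite mulr_sumr; apply: eq_bigr => b _.
    rewrite mulrC /p -sum_ucosDB.
    apply: eq_bigr => c _; apply: eq_bigr => d _.
    by congr ucos; rewrite /w !intrD !mulrNz; ring.
  rewrite exchange_big big1 //= => a _; rewrite exchange_big big1 //= => b _.
  rewrite exchange_big big1 //= => c _; rewrite exchange_big big1 //= => d _.
  rewrite sum_ucos //; case: ifP => // /small h; exfalso; apply: nox.
  exists b, a, d, c; apply/eqP; rewrite -subr_eq0 -h; last first.
    have := vN a; have := vN b; have := vN c; have := vN d.
    by rewrite /M; lia.
  by apply/eqP; ring.
(* Termwise: p r ^+ 2 * cos >= [r = 0] m^4 - T p r. *)
have : m ^+ 4 - T * (M%:R * m) <= 0.
  rewrite -[X in _ <= X]sum0 -sum_p mulr_sumr.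
  pose r0 : 'I_M := Ordinal M0.
  have -> : m ^+ 4 = \sum_r (if r == r0 then m ^+ 4 else 0).
    by rewrite -big_mkcond big_pred1_eq.
  rewrite -sumrB; apply: ler_sum => r _; case: eqP => [->|_].
    have -> : p r0 = m ^+ 2.
      rewrite /p /w; under eq_bigr => a _ do
        under eq_bigr => b _ do rewrite !mulr0 !mul0r subrr ucos0.
      by rewrite !sumr_const -[_ *+ _]mulr_natr -/m expr2.
    rewrite mulr0 mul0r ucos0 mulr1 -exprM gerBl.
    by rewrite mulr_ge0 ?ltW // exprn_gt0.
  rewrite sub0r; have [/spec_ge0 c0|/ltW pT] := leP T (p r).
    apply: (@le_trans _ _ 0); first by rewrite oppr_le0 mulr_ge0 // ltW.
    by rewrite mulr_ge0 // sqr_ge0.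
  apply: (@le_trans _ _ (- p r ^+ 2)).
    by rewrite lerN2 expr2 ler_wpM2r.
  rewrite -[leLHS]mulrN1 ler_wpM2l ?sqr_ge0 //; exact: cos_geN1.
apply/negP; rewrite -ltNge subr_gt0.
have -> : T * (M%:R * m) = (M%:R ^+ 2) * (m ^+ 2) / (10 * f%:R ^+ 2).
  by rewrite /T; field; rewrite gt_eqF.
rewrite ltr_pdivrMr; last by rewrite mulr_gt0 ?exprn_gt0.
have : M%:R ^+ 2 <= 9 * f%:R ^+ 2 * m ^+ 2.
  have -> : 9 * f%:R ^+ 2 * m ^+ 2 = (3 * f%:R * m) ^+ 2 by ring.
  by rewrite ler_pXn2r // nnegrE ?mulr_ge0 // ltW.
move=> /(ler_wpM2r (sqr_ge0 m)) /le_lt_trans; apply.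
rewrite -subr_gt0 (_ : _ - _ = f%:R ^+ 2 * m ^+ 4); last by ring.
by rewrite mulr_gt0 ?exprn_gt0.
Qed.

(** If finitely many translates of A cover Z then (A - A) + (A - A) contains a
    Bohr neighbourhood of 0. For each N some translate of A contains at least
    the proportion 1 / size F of 0, ..., N, and translating does not change
    differences, so the finite case applies with a number K of frequencies
    that does not depend on N. The frequencies form a point of a compact cube;
    a cluster point for N tending to infinity works for every x. *)
Lemma bogolyubov_folner (A : set int) (F : seq int) :
    (forall n, exists2 k, k \in F & A (n - k)) ->
  exists (K : nat) (theta : 'I_K -> R), (forall i, 0 <= theta i <= 1) /\
    forall x : int,
    (forall i, exists k : int, `|x%:~R * theta i - k%:~R| < 1 / 4) ->
    exists a b c d, [/\ A a, A b, A c & A d] /\ x = (a - b) + (c - d).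
Proof.
move=> AF; pose K := (10 * size F ^ 2)%N.
have step (N : nat) : exists th : 'rV[R]_K,
    (forall i, `[0, 1]%classic (th ord0 i)) /\
    forall x : int, `|x| <= N.+1%:Z ->
      (forall i, 0 <= ucos (x%:~R * th ord0 i)) ->
      exists a b c d, [/\ A a, A b, A c & A d] /\ x = (a - b) + (c - d).
  pose B k := [set n : 'I_N.+1 | `[<A ((n : nat)%:Z - k)>]]%SET.
  have [k Bk] : exists k, (N.+1 <= size F * #|B k|)%N.
    apply: contrapT => noB.
    have cover : (N.+1 <= \sum_(k <- F) #|B k|)%N.
      rewrite -[X in (X <= _)%N]card_ord -sum1_card.
      under [leqRHS]eq_bigr => k _ do rewrite -sum1_card big_mkcond /=.
      rewrite exchange_big /=; apply: leq_sum => n _.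
      have [k kF Ak] := AF (n : nat)%:Z.
      by rewrite (big_rem k kF) /= inE (asboolT Ak).
    have : (size F * \sum_(k <- F) #|B k| <= size F * N)%N.
      have -> : (size F * N = \sum_(k <- F) N)%N.
        by rewrite big_const_seq count_predT iter_addn_0 mulnC.
      rewrite big_distrr /=.
      apply: leq_sum => k _; rewrite -ltnS ltnNge; apply/negP => h.
      by apply: noB; exists k.
    have F0 : (0 < size F)%N.
      by have [k0 + _] := AF 0; case: (F).
    by rewrite leq_pmul2l // leqNgt cover.
  pose v (i : {n | n \in B k}) : int := (val (val i))%:Z.
  have [||||th [th01 thP]] := @bogolyubov_finite {n | n \in B k} v N.+1 (size F).
  - by [].
  - by rewrite card_sig.
  - by move=> i j [] /val_inj/val_inj.
  - by move=> i; rewrite /v ltz_nat ltn_ord.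
  exists (\row_i th i); split=> [i|x xN xth].
    by rewrite mxE /= in_itv /= th01.
  have [|a [b [c [d ->]]]] := thP x xN.
    by move=> i; have := xth i; rewrite mxE.
  exists (v a - k), (v b - k), (v c - k), (v d - k); split; last by ring.
  split.
  - by have := valP a; rewrite inE => /asboolP.
  - by have := valP b; rewrite inE => /asboolP.
  - by have := valP c; rewrite inE => /asboolP.
  - by have := valP d; rewrite inE => /asboolP.
have [th thP] := choice step.
have cpt : compact [set w : 'rV[R]_K | forall i, `[0, 1]%classic (w ord0 i)].
  apply: (@rV_compact R K (fun=> `[0, 1]%classic)) => i.
  exact: segment_compact.
have [|t [t01 clt]] := cpt (th @ \oo) (fmap_proper_filter th _).
  by exists 0%N => // N _; exact: (thP N).1.
exists K, (t ord0); split=> [i|x xint]; first exact: t01.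
have xt i : 0 < ucos (x%:~R * t ord0 i).
  by have [k] := xint i; exact: ucos_gt0.
have : nbhs t [set w : 'rV[R]_K | forall i, 0 < ucos (x%:~R * w ord0 i)].
  apply: (@filter_forall _ _
    (fun i (w : 'rV[R]_K) => 0 < ucos (x%:~R * w ord0 i)) (nbhs t)) => i.
  have cont : continuous (fun w : 'rV[R]_K => ucos (x%:~R * w ord0 i)).
    move=> w; apply: (@continuous_comp _ R R _ (fun y => ucos (x%:~R * y)) w).
      exact: coord_continuous.
    apply: (@continuous_comp R R R ( *%R x%:~R) (@ucos R)).
      exact: mulrl_continuous.
    exact: continuous_ucos.
  exact: (cont t _ (lt_nbhsr (xt i))).
have late : (th @ \oo) (th @` [set N | (`|x| <= N)%N]).
  by apply: filterS (nbhs_infty_ge `|x|%N) => N /= xN; exists N.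
move=> /(clt _ _ late) [_ [[N xN <-] xthN]].
by apply: (thP N).2 => [|i]; [move: xN => /=; lia|exact/ltW/xthN].
Qed.

End Bogolyubov.

(** * A base of neighbourhoods of 0 in the Bohr topology *)

Section BohrBase.
Variable R : realType.
Implicit Types (x y d rho : R) (n : int) (chi : R -> R[i]^o).

Lemma cvg_complex (T : Type) (F : set_system T) (f : T -> R[i]^o) (l : R[i]^o) :
    Filter F ->
    complex.Re (f t) @[t --> F] --> complex.Re l ->
    complex.Im (f t) @[t --> F] --> complex.Im l ->
  f @ F --> l.
Proof.
move=> FF /cvgrPdist_lt fRe /cvgrPdist_lt fIm; apply/cvgrPdist_lt => -[e e'].
rewrite ltcE /= => /andP[/eqP -> e0].
have e20 : 0 < e / 2 by rewrite divr_gt0.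
near=> t.
have /= : `|complex.Re l - complex.Re (f t)| < e / 2 by near: t; exact: fRe.
have /= : `|complex.Im l - complex.Im (f t)| < e / 2 by near: t; exact: fIm.
rewrite normc_def ltcR.
move=> dIm dRe; rewrite -(gtr0_norm e0) -sqrtr_sqr ltr_sqrt ?exprn_gt0 //.
move: dIm dRe; case: (l) (f t) => [a b] [a' b'] /=.
rewrite !ltr_norml => /andP[b0 b1] /andP[a0 a1]; nra.
Unshelve. all: by end_near. Qed.

Lemma Re_continuous : continuous (fun z : R[i]^o => complex.Re z : R).
Proof.
move=> z; apply/(@cvgrPdist_lt R R _ (nbhs z) (nbhs_filter z)) => e e0.
have ec0 : (0 : R[i]) < (e%:C)%C by rewrite ltcR.
have := nbhsx_ballx z (e%:C)%C ec0; apply: filterS => t.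
rewrite -ball_normE /= => zt; rewrite -ltcR; apply: le_lt_trans zt.
have -> : complex.Re z - complex.Re t = complex.Re (z - t).
  by case: (z) (t) => ? ? [].
exact: normc_ge_Re.
Qed.

Lemma character0 chi : is_character chi -> chi 0 = 1.
Proof.
move=> [chiD chi1 _].
have chi_neq0 : chi 0 != 0 by rewrite -normr_gt0 chi1.
by apply: (mulfI chi_neq0); rewrite mulr1 -chiD addr0.
Qed.

Lemma turn_character (t : R) :
  is_character (fun x => (ucos (t * x) +i* usin (t * x))%C : R[i]^o).
Proof.
split=> [x y|x|x].
- by rewrite mulrDr ucosD usinD; simpc; congr (_ +i* _)%C; ring.
- by rewrite normc_def /= ucos2Dusin2 sqrtr1.
- apply: cvg_complex => /=.
  + apply: (@continuous_comp R R R ( *%R t) (@ucos R) x).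
      exact: mulrl_continuous.
    exact: continuous_ucos.
  + apply: (@continuous_comp R R R ( *%R t) (@usin R) x).
      exact: mulrl_continuous.
    exact: continuous_usin.
Qed.

(** The preimage of a neighbourhood of 0 in the circle R / rho Z; these sets
    stand in for the characters in the rest of the argument. *)
Definition near_multiple rho d : set R :=
  [set x | exists n : int, `|x - n%:~R * rho| < d].

Lemma Re_character_double chi y : is_character chi ->
  complex.Re (chi (y + y)) = 2 * complex.Re (chi y) ^+ 2 - 1.
Proof.
move=> [chiD chi1 _]; rewrite chiD; have := chi1 y; rewrite normc_def.
case: (chi y) => a b /= [] /(congr1 (fun t => t ^+ 2)).
rewrite sqr_sqrtr ?addr_ge0 ?sqr_ge0 // expr1n => ab.
by move: ab; rewrite !expr2; lra.
Qed.

(** While the real part c of chi stays positive, the duplication formula at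
    least doubles 1 - c when the argument is doubled. So a nontrivial character
    reaches c <= 0, and c vanishes at some positive t by the intermediate value
    theorem. Then chi t is i or - i, and 4 t is a period. *)
Lemma character_period chi : is_character chi ->
  exists2 rho, 0 < rho & chi rho = 1.
Proof.
move=> chiP; have [chiD chi1 chic] := chiP.
have [triv|/existsNP[x chix]] := pselect (forall x, chi x = 1).
  by exists 1.
pose c y := complex.Re (chi y).
have c_lt1 y : chi y <> 1 -> c y < 1.
  have := chi1 y; rewrite /c normc_def; case: (chi y) => a b /= [].
  move=> /(congr1 (fun t => t ^+ 2)).
  rewrite sqr_sqrtr ?addr_ge0 ?sqr_ge0 // expr1n => ab chi_neq1.
  have [//|a1] := ltP a 1; case: chi_neq1; congr (_ +i* _)%C; nra.
have {x chix} [y y0 cy] : exists2 y, 0 < y & c y < 1.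
  have [x0|x0|x0] := ltgtP x 0.
  - exists (- x); first by rewrite oppr_gt0.
    apply: c_lt1 => chiNx; apply: chix.
    by rewrite -[LHS]mul1r -chiNx -chiD addNr character0.
  - by exists x => //; exact: c_lt1.
  - by case: chix; rewrite x0 character0.
have [z z0 cz] : exists2 z, 0 < z & c z <= 0.
  apply: contrapT => nz.
  have cpos z : 0 < z -> 0 < c z.
    by move=> z0; rewrite ltNge; apply/negP => cz; apply: nz; exists z.
  have grow k : 2 ^+ k * (1 - c y) <= 1 - c (2 ^+ k * y).
    elim: k => [|k IHk]; first by rewrite expr0 !mul1r.
    have yk : 0 < 2 ^+ k * y by rewrite mulr_gt0 // exprn_gt0.
    rewrite exprS -!mulrA (_ : 2 * (_ * y) = 2 ^+ k * y + 2 ^+ k * y);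
      last by ring.
    rewrite {2}/c (Re_character_double _ chiP) -/(c _).
    have c0 := cpos _ yk; have : c (2 ^+ k * y) <= 1.
      have [h|/c_lt1/ltW //] := pselect (chi (2 ^+ k * y) = 1).
        by rewrite /c h.
    nra.
  have y1 : 0 < (1 - c y)^-1 by rewrite invr_gt0 subr_gt0.
  have := archi_boundP (ltW y1); set k := Num.bound _ => yk.
  have : (1 - c y)^-1 < 2 ^+ k.
    by rewrite (lt_trans yk) // -natrX ltr_nat ltn_expl.
  rewrite invf_plt ?posrE ?exprn_gt0 ?subr_gt0 // => ky.
  have := grow k; have := cpos (2 ^+ k * y).
  rewrite mulr_gt0 ?exprn_gt0 // => /(_ isT) ? ?.
  have : 1 < 2 ^+ k * (1 - c y) by rewrite mulrC -ltr_pdivrMr ?exprn_gt0 // mul1r.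
  lra.
have cc : continuous c.
  by move=> t; apply: continuous_comp; [exact: chic|exact: Re_continuous].
have c0 : c 0 = 1 by rewrite /c character0.
have [||t] := @IVT R c 0 z 0 (ltW z0).
- exact/continuous_subspaceT.
- by rewrite c0 ge_min cz orbT le_max ler01.
rewrite in_itv /= => /andP[t0 _] ct.
have {}t0 : 0 < t.
  by rewrite lt_neqAle t0 andbT; apply: contraPneq ct => <-; rewrite c0; lra.
exists (t + t + (t + t)); first by rewrite !addr_gt0.
have : chi (t + t) = -1.
  rewrite chiD; have := chi1 t; move: ct; rewrite normc_def /c.
  case: (chi t) => a b /= -> [] /(congr1 (fun t => t ^+ 2)).
  rewrite sqr_sqrtr ?addr_ge0 ?sqr_ge0 // expr1n => ab.
  by apply/eqP; rewrite eq_complex /=; apply/andP; split; apply/eqP; nra.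
by move=> chi2t; rewrite chiD chi2t mulrNN mulr1.
Qed.

(** A character with chi rho = 1 factors through R / rho Z, so continuity at 0
    controls it near all multiples of rho. *)
Lemma character_near_multiple chi : is_character chi ->
  exists2 rho, 0 < rho & forall A, nbhs (1 : R[i]^o) A ->
    exists2 d, 0 < d & forall x, near_multiple rho d x -> A (chi x).
Proof.
move=> chiP; have [chiD chi1 chic] := chiP.
have [rho rho0 chirho] := character_period chiP; exists rho => // A A1.
have chin (n : nat) : chi (n%:R * rho) = 1.
  elim: n => [|n IHn]; first by rewrite mul0r character0.
  by rewrite -natr1 mulrDl mul1r chiD IHn chirho mulr1.
have chiz n : chi (n%:~R * rho) = 1.
  case: n => n; first exact: chin.
  rewrite NegzE -[LHS]mulr1 -(chin n.+1) -chiD -mulrDl.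
  by rewrite rmorphN /= addNr mul0r character0.
have : nbhs (0 : R) (chi @^-1` A) by apply: (chic 0); rewrite character0.
move=> /nbhs_ballP[d /= d0 dA]; exists d => // x [n xn].
rewrite -(subrK (n%:~R * rho) x) chiD chiz mulr1; apply: dA.
by rewrite -ball_normE /= sub0r normrN.
Qed.

(** Together with near_multiple_bohr, this says that the finite intersections
    of the sets near_multiple rho d form a base at 0. *)
Lemma cvg_bohr0 (F : set_system R) : Filter F ->
    (forall rho d, 0 < rho -> 0 < d -> F (near_multiple rho d)) ->
  F --> (0 : bohr R).
Proof.
move=> FF Fnear; apply: cvg_bohr => chi chiP.
have [rho rho0 chi_near] := character_near_multiple chiP.
move=> A; rewrite (character0 chiP) => /chi_near[d d0 dA].
exact: filterS dA (Fnear _ _ rho0 d0).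
Qed.

(** Being near a multiple of rho is a condition on the character of frequency
    1 / rho alone: its real part has to be large. *)
Lemma near_multiple_bohr rho d : 0 < rho -> 0 < d ->
  nbhs (0 : bohr R) (near_multiple rho d).
Proof.
move=> rho0 d0; pose e := Num.min (d / rho) (1 / 2).
have e0 : 0 < e by rewrite lt_min divr_gt0 //= divr_gt0.
have e1 : e <= 1 / 2 by rewrite ge_min lexx orbT.
have cont := bohr_character_continuous (turn_character rho^-1).
have ue : ucos e < complex.Re (1 : R[i]).
  rewrite /= -(@ucos0 R) /ucos; have pi0 := pi_gt0 R.
  rewrite ltr_cos ?in_itv /= ?mul0r ?lexx ?pi_ge0 //.
    by rewrite mulr_gt0 // mulrn_wgt0.
  by apply/andP; split; nra.
have := @Re_continuous (1 : R[i]^o) _ (lt_nbhsr ue).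
rewrite -(character0 (turn_character rho^-1)) => /(cont 0) H.
apply: (@filterS _ (nbhs (0 : bohr R)) _ _ _ _ H) => x /=.
move=> /near_int_ucos[|n xn]; first by rewrite (ltW e0).
exists n; have : `|rho^-1 * x - n%:~R| < d / rho.
  by apply: lt_le_trans xn _; rewrite ge_min lexx.
rewrite ltr_pdivlMr // -{2}(gtr0_norm rho0) -normrM mulrBl.
by rewrite mulrAC mulVf ?gt_eqF // mul1r.
Qed.

End BohrBase.

(** * Invariance of the four properties under isomorphism *)

Section Isomorphism.
Variables (G H : topologicalGroupType) (f : G -> H) (g : H -> G).
Hypotheses (fM : {morph f : x y / (x * y)%g >-> (x * y)%g}).
Hypotheses (fK : cancel f g) (gK : cancel g f).
Hypotheses (fc : continuous f) (gc : continuous g).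

Let gM : {morph g : x y / (x * y)%g >-> (x * y)%g}.
Proof. by move=> x y; rewrite -{1}(gK x) -{1}(gK y) -fM fK. Qed.

Let morph1 (K L : topologicalGroupType) (h : K -> L) :
  {morph h : x y / (x * y)%g >-> (x * y)%g} -> h 1%g = 1%g.
Proof. by move=> hM; apply: (mulgI (h 1%g)); rewrite -hM !mulg1. Qed.

Let morphX (K L : topologicalGroupType) (h : K -> L) x (n : nat) :
  {morph h : x y / (x * y)%g >-> (x * y)%g} -> h (x ^+ n)%g = (h x ^+ n)%g.
Proof.
move=> hM; elim: n => [|n IHn]; first by rewrite !expg0 morph1.
by rewrite !expgS hM IHn.
Qed.

Lemma iso_one_parametric (R : realType) : one_parametric R H ->
  one_parametric R G.
Proof.
move=> [phi [phiD phic phi_surj]]; exists (g \o phi); split.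
- by move=> x y /=; rewrite phiD gM.
- by move=> x; apply: continuous_comp; [exact: phic|exact: gc].
- by move=> x; have [t tx] := phi_surj (f x); exists t; rewrite /= tx fK.
Qed.

Lemma iso_totally_bounded : totally_bounded H -> totally_bounded G.
Proof.
move=> tbH U oU U1.
have [||F finF HF] := tbH (g @^-1` U).
- by move/continuousP: gc; exact.
- by rewrite /= (morph1 gM).
exists (g @` F); first exact: finite_image.
apply/seteqP; split=> // x _.
have : (\bigcup_(x in F) [set (x * u)%g | u in g @^-1` U]) (f x) by rewrite HF.
move=> [y Fy [u Uu yux]]; exists (g y); first by exists y.
by exists (g u) => //; rewrite -gM yux fK.
Qed.

Lemma iso_nat_scaled : nat_scaled H -> nat_scaled G.
Proof.
move=> nsH n n0 U oU.
have -> : [set (x ^+ n)%g | x in U] =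
    f @^-1` [set (x ^+ n)%g | x in g @^-1` U].
  apply/seteqP; split=> [_ [x Ux <-]|x /= [y Uy yx]].
    by exists (f x); rewrite /= ?fK // (morphX _ _ fM).
  by exists (g y) => //; rewrite -(morphX _ _ gM) yx fK.
move/continuousP: fc; apply; apply: nsH => //.
by move/continuousP: gc; exact.
Qed.

Lemma iso_monothetic : monothetic G -> monothetic H.
Proof.
move=> [x x_dense]; exists (f x) => O [z Oz] oO.
have [||y [/= Oy [n xy]]] := x_dense (f @^-1` O).
- by exists (g z); rewrite /= gK.
- by move/continuousP: fc; exact.
exists (f y); split=> //; exists n.
have fV u : f (u^-1)%g = ((f u)^-1)%g.
  by apply: (mulgI (f u)); rewrite -fM !mulgV morph1.
by case: xy => ->; rewrite ?fV (morphX _ _ fM); [left|right].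
Qed.

End Isomorphism.

(** * The four properties of the Bohr line *)

Section BohrProperties.
Variable R : realType.
Let B : topologicalGroupType := Algebra.to_multiplicative (bohr R).
Implicit Types (x y rho d : R) (n : nat).

Lemma expg_bohr (x : B) n : (x ^+ n)%g = (n%:R * (x : R)) :> R.
Proof.
elim: n => [|n IHn]; first by rewrite expg0 mul0r.
by rewrite expgS -natr1 mulrDl mul1r addrC -IHn.
Qed.

Lemma bohr_one_parametric : one_parametric R B.
Proof.
exists id; split=> // [x|x]; last by exists x.
apply: (@cvg_bohr R (nbhs (x : R)) x (nbhs_filter x)) => chi [_ _ chic].
exact: chic.
Qed.

Lemma nbhs_bohrD (x : bohr R) (U : set (bohr R)) : nbhs x U ->
  nbhs (0 : bohr R) [set y | U (x + y)].
Proof.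
move=> xU; have := @bohr_add_continuous R (x, 0) U.
rewrite /= addr0 => /(_ xU)[[V W] /= [xV W0] VWU].
apply: filterS W0 => y Wy; apply: (VWU (x, y)); split=> //=.
exact: nbhs_singleton.
Qed.

Lemma nbhs_bohrB (x : bohr R) (U : set (bohr R)) : nbhs (0 : bohr R) U ->
  nbhs x [set y | U (y - x)].
Proof.
move=> U0; have := @bohr_add_continuous R (x, - x) U.
rewrite /= subrr => /(_ U0)[[V W] /= [xV W0] VWU].
apply: filterS xV => y Vy; apply: (VWU (y, - x)); split=> //=.
exact: nbhs_singleton.
Qed.

(** Some finite colouring of the line has all differences of equally coloured
    points in U. Such U form a filter, because two colourings can be combined;
    so comparing it with the Bohr neighbourhoods of 0 reduces total
    boundedness to the sets near_multiple rho d. *)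
Definition finitely_colored (U : set R) : Prop :=
  exists (I : finType) (c : R -> I), forall x y, c x = c y -> U (y - x).

Lemma finitely_colored_filter : Filter finitely_colored.
Proof.
split.
- by exists unit, (fun=> tt).
- move=> U V [I [c cU]] [J [c' cV]]; exists (I * J)%type, (fun x => (c x, c' x)).
  by move=> x y [/cU ? /cV ?].
- move=> U V UV [I [c cU]]; exists I, c => x y /cU; exact: UV.
Qed.

(** The circle R / rho Z is cut into k arcs of length less than d. *)
Lemma finitely_colored_near_multiple rho d : 0 < rho -> 0 < d ->
  finitely_colored (near_multiple rho d).
Proof.
move=> rho0 d0; pose k := Num.bound (rho / d).
have kd : rho / d < k%:R by apply: archi_boundP; rewrite ltW // divr_gt0.
have k0 : (0 : R) < k%:R by rewrite (lt_trans _ kd) // divr_gt0.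
pose n x := Num.floor (x / rho).
pose m x := Num.floor ((x / rho - (n x)%:~R) * k%:R).
have mP x : (0 <= m x)%R && (m x < k%:Z)%R.
  have /andP[h1 h2] := floor_itv (x / rho); rewrite intrD -/(n x) in h1 h2.
  rewrite floor_ge0 mulr_ge0 ?subr_ge0 ?(ltW k0) //=.
  rewrite floor_lt_int gtr_pMl //; lra.
(* There are k colours; the type 'I_k.+1 is the one that inord produces. *)
exists 'I_k.+1, (fun x => inord `|m x|) => x y /(congr1 val) /=.
rewrite !inordK; first last.
- by have := mP x; lia.
- by have := mP y; lia.
move=> mxy; have {mxy} mm : m x = m y by have := mP x; have := mP y; lia.
exists (n y - n x).
have /andP[h1 h2] := floor_itv ((x / rho - (n x)%:~R) * k%:R).
have /andP[h3 h4] := floor_itv ((y / rho - (n y)%:~R) * k%:R).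
rewrite intrD -!/(m _) mm in h1 h2 h3 h4.
have : `|(y - x - (n y - n x)%:~R * rho) * (k%:R / rho)| < 1.
  rewrite (_ : _ * _ = (y / rho - (n y)%:~R) * k%:R -
      (x / rho - (n x)%:~R) * k%:R).
    by rewrite ltr_norml; apply/andP; split; lra.
  by rewrite intrB; field; rewrite gt_eqF.
rewrite normrM (gtr0_norm (divr_gt0 k0 rho0)).
rewrite -ltr_pdivlMr ?divr_gt0 // mul1r invf_div.
by move=> /lt_trans; apply; rewrite ltr_pdivrMr // mulrC -ltr_pdivrMr.
Qed.

Lemma bohr_totally_bounded : totally_bounded B.
Proof.
move=> U oU U0.
have : finitely_colored U.
  have := @cvg_bohr0 R _ finitely_colored_filter finitely_colored_near_multiple.
  by apply; exact: open_nbhs_nbhs.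
move=> [I [c cU]].
have /choice[r rP] : forall i : I, exists x : R, (exists y, c y = i) -> c x = i.
  move=> i; have [[x cx]|nx] := pselect (exists y, c y = i); first by exists x.
  by exists 0 => /nx.
exists (range r); first exact: finite_image.
apply/seteqP; split=> // x _; exists (r (c x)); first by exists (c x).
have rx : c (r (c x)) = c x by apply: rP; exists x.
by exists ((x : R) - r (c x)); [exact: cU|exact: subrKC].
Qed.

(** Rescaling the argument of a character gives a character. *)
Lemma bohr_div_continuous n : (0 < n)%N ->
  continuous (fun x : bohr R => (x : R) / n%:R : bohr R).
Proof.
move=> n0 x; have FF : Filter ((fun y : bohr R => (y : R) / n%:R : bohr R) @ x).
  exact: (fmap_filter _ (nbhs_filter x)).
apply: cvg_bohr => chi [chiD chi1 chic].
apply: (@bohr_character_continuous R (fun y : R => chi (y / n%:R))).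
split=> [y z|y|y].
- by rewrite mulrDl chiD.
- exact: chi1.
- apply: (@continuous_comp R R _ (fun y => y / n%:R) chi y); last exact: chic.
  exact: mulrr_continuous.
Qed.

Lemma bohr_nat_scaled : nat_scaled B.
Proof.
move=> n n0 U oU; have nR : (n%:R : R) != 0 by rewrite pnatr_eq0 -lt0n.
have -> : [set (x ^+ n)%g | x in U] =
    (fun x : bohr R => (x : R) / n%:R : bohr R) @^-1` U.
  apply/seteqP; split=> [_ [x Ux <-]|x /= Ux].
    by rewrite /preimage /= expg_bohr mulrAC divff // mul1r.
  by exists ((x : R) / n%:R) => //; rewrite expg_bohr mulrC divfK.
by move/continuousP: (bohr_div_continuous n0); exact.
Qed.

(** The multiples of g are also multiples of rho = |g|, and none of them is
    close to rho / 2 modulo rho. For g = 0 any period will do. *)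
Lemma bohr_not_monothetic : ~ monothetic B.
Proof.
move=> [g g_dense]; pose rho : R := if (g : R) == 0 then 1 else `|g : R|.
have rho0 : 0 < rho by rewrite /rho; case: ifPn => //; rewrite normr_gt0.
have grho : exists m : int, (g : R) = m%:~R * rho.
  rewrite /rho; case: eqP => [->|_]; first by exists 0; rewrite mul0r.
  have [_|_] := ger0P (g : R); first by exists 1; rewrite mul1r.
  by exists (-1); rewrite mulN1r opprK.
have {grho} gcyc y : cyclic_subgroup g y -> exists m : int, (y : R) = m%:~R * rho.
  have [m gm] := grho; move=> [n [->|->]].
    by exists (n%:Z * m); rewrite expg_bohr {1}gm mulrA intrM.
  exists (- (n%:Z * m)); rewrite -[LHS]/(- ((g ^+ n)%g : R)).
  by rewrite expg_bohr {1}gm mulrA intrN intrM mulNr.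
have d0 : 0 < rho / 4 by rewrite divr_gt0.
have nb := @nbhs_bohrB (rho / 2) _ (near_multiple_bohr rho0 d0).
pose O : set B := [set y | near_multiple rho (rho / 4) ((y : R) - rho / 2)].
have [|y [/interior_subset Oy /gcyc[m ym]]] :=
  g_dense (interior O) _ (@open_interior B O).
  by exists (rho / 2); exact: nb.
case: Oy => k; rewrite ym => h.
have : `|(2 * m - 1 - 2 * k)%:~R * (rho / 2)| < rho / 4.
  apply: le_lt_trans h; rewrite le_eqVlt; apply/orP; left; apply/eqP.
  by congr `|_|; rewrite !intrB !intrM; field.
rewrite normrM (gtr0_norm (divr_gt0 rho0 _)) // -ltr_pdivlMr ?divr_gt0 //.
rewrite (_ : rho / 4 / (rho / 2) = 2^-1); last by field; rewrite gt_eqF.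
rewrite -intr_norm => h2.
have : (`|2 * m - 1 - 2 * k|%:~R : R) < 1%:~R.
  by rewrite (lt_trans h2) // invf_lt1 // ltr1n.
by rewrite ltr_int; lia.
Qed.

End BohrProperties.

(** * Closed subgroups of the line *)

Section RealSubgroups.
Variable R : realType.
Implicit Types (x y d s : R) (n : int).

Lemma near_multiple_all s x : 0 < s ->
  (forall d, 0 < d -> near_multiple s d x) -> exists n, x = n%:~R * s.
Proof.
move=> s0 near_x; have [n xn] := near_x (s / 2) (divr_gt0 s0 (ltr0n _ 2)).
exists n; apply/eqP; rewrite -subr_eq0 -normr_le0 leNgt; apply/negP => d0.
have [k xk] := near_x _ d0.
suff nk : n = k by rewrite nk ltxx in xk.
apply/eqP; rewrite -subr_eq0 -normr_le0 -ltzD1 add0r -(ltr_int R) intr_norm intrB.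
rewrite -(ltr_pM2r s0) -{1}(gtr0_norm s0) -normrM mul1r.
have -> : (n%:~R - k%:~R) * s = (x - k%:~R * s) - (x - n%:~R * s) by ring.
apply: le_lt_trans (ler_normB _ _) _; lra.
Qed.

(** The generator is the infimum s of the positive elements: if s were 0 the
    subgroup would be dense, hence everything; and the remainder of an element
    modulo s is an element smaller than s, hence 0. *)
Lemma closed_subgroup_discrete (H : set R) rho :
    (forall x y, H x -> H y -> H (x - y)) ->
    (forall x, (forall d, 0 < d -> exists2 y, H y & `|x - y| < d) -> H x) ->
    0 < rho -> H rho -> (exists x, ~ H x) ->
  exists2 s, 0 < s & forall x, H x <-> exists n, x = n%:~R * s.
Proof.
move=> HB Hcl rho0 Hrho [z nHz].
have H0 : H 0 by rewrite -(subrr rho); exact: HB.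
have HN x : H x -> H (- x) by move=> Hx; rewrite -sub0r; exact: HB.
have HD x y : H x -> H y -> H (x + y).
  by move=> Hx Hy; rewrite -(opprK y); apply: HB => //; exact: HN.
have Hn x (n : nat) : H x -> H (n%:R * x).
  move=> Hx; elim: n => [|n IHn]; first by rewrite mul0r.
  by rewrite -natr1 mulrDl mul1r; exact: HD.
have Hz x n : H x -> H (n%:~R * x).
  move=> Hx; case: n => n; first exact: Hn.
  by rewrite NegzE rmorphN mulNr; apply: HN; exact: Hn.
pose P := [set x | 0 < x /\ H x]; pose s := inf P.
have Prho : P rho by [].
have Plb : lbound P 0 by move=> x [/ltW].
have infP : has_inf P by split; [exists rho|exists 0].
have s_le x : P x -> s <= x by apply: ge_inf; exists 0.
have s0 : 0 <= s by apply: lb_le_inf => //; exists rho.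
have sapp d : 0 < d -> exists2 p, P p & p < s + d.
  by move=> d0; exact: inf_adherent.
have rem p x : 0 < p -> 0 <= x - (Num.floor (x / p))%:~R * p < p.
  move=> p0; have /andP[h1 h2] := floor_itv (x / p); rewrite intrD in h1 h2.
  move: h1 h2; rewrite ler_pdivlMr // ltr_pdivrMr // mulrDl mul1r => h1 h2.
  by rewrite subr_ge0 h1 /=; lra.
have {}s0 : 0 < s.
  rewrite lt_neqAle s0 andbT; apply: contra_notN nHz => /eqP s_eq0.
  apply: Hcl => d d0; have [p [p0 Hp]] := sapp d d0.
  rewrite -s_eq0 add0r => pd.
  exists ((Num.floor (z / p))%:~R * p); first exact: Hz.
  by have /andP[h1 h2] := rem p z p0; rewrite ger0_norm // (lt_trans h2).
have Hs : H s.
  apply: Hcl => d d0; have [p Pp ps] := sapp d d0; exists p; first by case: Pp.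
  by have := s_le p Pp; rewrite distrC => ?; rewrite ger0_norm ?subr_ge0 //; lra.
exists s => // x; split=> [Hx|[n ->]]; last exact: Hz.
exists (Num.floor (x / s)); apply/eqP; rewrite -subr_eq0.
have /andP[h1 h2] := rem s x s0; rewrite eq_le h1 andbT leNgt.
apply/negP => h0; have : s <= x - (Num.floor (x / s))%:~R * s.
  by apply: s_le; split=> //; apply: HB => //; exact: Hz.
by rewrite leNgt h2.
Qed.

End RealSubgroups.

(** * Neighbourhoods in a topological group *)

Section TopologicalGroups.
Variable G : topologicalGroupType.
Implicit Types (x y : G) (U W : set G).

Lemma nbhs1_split U : nbhs (1%g : G) U -> exists2 W, nbhs (1%g : G) W &
  forall x y, W x -> W y -> U (x * y)%g /\ U (x * y^-1)%g.
Proof.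
move=> U1; have := @mulg_continuous G (1%g, 1%g) U.
rewrite /= mulg1 => /(_ U1)[[V W] /= [V1 W1] VWU].
have : nbhs (1%g : G) [set y | W (y^-1)%g].
  by apply: (@invg_continuous G 1%g); rewrite invg1.
move=> WV; exists (V `&` W `&` [set y | W (y^-1)%g]).
  by do 2?apply: filterI.
move=> x y [[Vx _] _] [[_ Wy] WVy].
by split; [apply: (VWU (x, y))|apply: (VWU (x, (y^-1)%g))].
Qed.

Lemma nbhs_mull x U : nbhs x U -> nbhs (1%g : G) [set y | U (x * y)%g].
Proof.
move=> xU; have := @mulg_continuous G (x, 1%g) U.
rewrite /= mulg1 => /(_ xU)[[V W] /= [xV W1] VWU].
apply: filterS W1 => y Wy; apply: (VWU (x, y)); split=> //=.
exact: nbhs_singleton.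
Qed.

Lemma nbhs_divl x U : nbhs (1%g : G) U -> nbhs x [set y | U (x^-1 * y)%g].
Proof.
move=> U1; have := @mulg_continuous G ((x^-1)%g, x) U.
rewrite /= mulVg => /(_ U1)[[V W] /= [xV W1] VWU].
apply: filterS W1 => y Wy; apply: (VWU ((x^-1)%g, y)); split=> //=.
exact: nbhs_singleton.
Qed.

End TopologicalGroups.

(** * One-parametric groups *)

Section OneParametric.
Variables (R : realType) (G : topologicalGroupType) (phi : R -> G).
Hypothesis phiD : {morph phi : x y / x + y >-> (x * y)%g}.
Hypothesis phic : continuous phi.
Hypothesis phi_surj : forall g, exists x, phi x = g.
Implicit Types (x y d rho s : R) (U W : set G).

Let phi0 : phi 0 = 1%g.
Proof. by apply: (mulgI (phi 0)); rewrite -phiD addr0 mulg1. Qed.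

Let phiN x : phi (- x) = ((phi x)^-1)%g.
Proof. by apply: (mulgI (phi x)); rewrite -phiD subrr phi0 mulgV. Qed.

Let phiB x y : phi (x - y) = (phi x * (phi y)^-1)%g.
Proof. by rewrite phiD phiN. Qed.

Let phiMn x (n : nat) : phi (n%:R * x) = (phi x ^+ n)%g.
Proof.
elim: n => [|n IHn]; first by rewrite mul0r phi0 expg0.
by rewrite -natr1 mulrDl mul1r addrC phiD IHn expgS.
Qed.

Lemma nbhs_phi U : nbhs (1%g : G) U ->
  exists2 d, 0 < d & forall x, `|x| < d -> U (phi x).
Proof.
move=> U1; have : nbhs (0 : R) (phi @^-1` U) by apply: phic; rewrite phi0.
move=> /nbhs_ballP[d /= d0 dU]; exists d => // x xd; apply: dU.
by rewrite -ball_normE /= sub0r normrN.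
Qed.

(** The preimage under phi of the closure of the subgroup generated by phi
    rho. Expressed with neighbourhoods of 1, it is visibly a closed subgroup
    of R. *)
Definition cyclic_hull rho : set R :=
  [set x | forall U, nbhs (1%g : G) U ->
    exists n : int, U (phi (x - n%:~R * rho))].

Lemma cyclic_hullB rho x y :
  cyclic_hull rho x -> cyclic_hull rho y -> cyclic_hull rho (x - y).
Proof.
move=> Hx Hy U /nbhs1_split[W W1 WU].
have [n xn] := Hx W W1; have [m ym] := Hy W W1; exists (n - m).
rewrite (_ : _ - _ = x - n%:~R * rho - (y - m%:~R * rho)); last first.
  by rewrite intrB; ring.
by rewrite phiB; exact: (WU _ _ xn ym).2.
Qed.

Lemma cyclic_hull_closed rho x :
  (forall d, 0 < d -> exists2 y, cyclic_hull rho y & `|x - y| < d) ->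
  cyclic_hull rho x.
Proof.
move=> Hx U /nbhs1_split[W W1 WU].
have [d d0 dW] := nbhs_phi W1; have [y Hy /dW xy] := Hx d d0.
have [n yn] := Hy W W1; exists n.
rewrite (_ : _ - _ = x - y + (y - n%:~R * rho)); last by ring.
by rewrite phiD; exact: (WU _ _ xy yn).1.
Qed.

Lemma cyclic_hull_gen rho : cyclic_hull rho rho.
Proof.
move=> U /nbhs_singleton U1; exists 1.
by rewrite mul1r subrr phi0.
Qed.

Lemma cyclic_hull_proper rho : ~ monothetic G -> exists x, ~ cyclic_hull rho x.
Proof.
move=> nmono; apply: contrapT => noH; apply: nmono.
exists (phi rho) => O [u Ou] oO.
have [x xu] := phi_surj u.
have Hx : cyclic_hull rho x by apply: contrapT => nHx; apply: noH; exists x.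
have : nbhs (1%g : G) [set v | O (u * v^-1)%g].
  apply: (@invg_continuous G 1%g [set v | O (u * v)%g]).
  rewrite invg1; apply: nbhs_mull; exact: open_nbhs_nbhs.
move=> /Hx[n /=]; rewrite -xu -phiN -phiD => On.
exists (phi (n%:~R * rho)); split; first by move: On; congr O; congr phi; ring.
case: n {On} => n; first by exists n; left; rewrite -phiMn.
by exists n.+1; right; rewrite -phiMn -phiN NegzE rmorphN mulNr.
Qed.

(** The closure K of the subgroup generated by phi rho is proper, so its
    preimage is s Z with rho = m s. The points of the circle R / s Z at
    distance at least d from 0 are represented by the compact interval
    [d, s - d]; its image avoids the closed set K, hence so do all its
    translates by a small element of G, and by periodicity phi x close to 1
    forces x close to s Z. *)
Lemma near_submultiple rho : ~ monothetic G -> 0 < rho ->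
  exists2 m : nat, (0 < m)%N & forall d, 0 < d ->
    exists2 U, nbhs (1%g : G) U &
      forall x, U (phi x) -> near_multiple (rho / m%:R) d x.
Proof.
move=> nmono rho0.
have [s s0 Hs] := closed_subgroup_discrete (@cyclic_hullB rho)
  (@cyclic_hull_closed rho) rho0 (@cyclic_hull_gen rho)
  (cyclic_hull_proper rho nmono).
have [m rhom] := (Hs rho).1 (@cyclic_hull_gen rho).
have m0 : 0 < m.
  by move: rho0; rewrite rhom pmulr_lgt0 // ltr0z.
exists `|m|%N; first by rewrite absz_gt0 gt_eqF.
have -> : rho / `|m|%N%:R = s.
  rewrite natr_absz gtr0_norm // rhom mulrAC divff ?mul1r //.
  by rewrite intr_eq0 gt_eqF.
move=> d d0.
have : \forall u \near (1%g : G),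
    `[d, s - d]%classic `<=` [set y | forall n : int, phi (y - n%:~R * rho) <> u].
  have /compact_near_coveringP := @segment_compact R d (s - d).
  apply => y; rewrite /= in_itv /= => /andP[dy yd].
  have : ~ cyclic_hull rho y.
    move=> /Hs[n yn].
    have n0 : 0 < n by rewrite -(ltr0z R) -(pmulr_lgt0 _ s0) -yn (lt_le_trans d0).
    have n1 : n < 1.
      by rewrite -(ltr_int R) -(ltr_pM2r s0) -yn mul1r; lra.
    by lia.
  move=> /existsNP[U /not_implyP[/nbhs1_split[W W1 WU] noU]].
  have [e e0 eW] := nbhs_phi W1.
  exists (ball y e, W); first by split => //=; exact: nbhsx_ballx.
  move=> [y' u] /= [yy' Wu] n nu; apply: noU; exists n.
  rewrite (_ : _ - _ = y - y' + (y' - n%:~R * rho)); last by ring.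
  rewrite phiD nu; apply: (WU _ _ _ Wu).1; apply: eW.
  by move: yy'; rewrite -ball_normE.
move=> /nbhs1_split[W W1 WU]; exists W => // x Wx.
pose k := Num.floor (x / s).
have /andP[h1 h2] := floor_itv (x / s); rewrite intrD -/k in h1 h2.
move: h1 h2; rewrite ler_pdivlMr // ltr_pdivrMr // mulrDl mul1r => h1 h2.
have [xd|xd] := ltP (x - k%:~R * s) d.
  by exists k; rewrite ger0_norm // subr_ge0.
have [xs|xs] := ltP (s - d) (x - k%:~R * s).
  exists (k + 1); rewrite intrD mulrDl mul1r ltr_norml.
  by apply/andP; split; lra.
have [n kn] := (Hs (k%:~R * s)).2 (ex_intro _ k erefl) W W1.
exfalso; apply: ((WU _ _ Wx kn).2 (x - k%:~R * s) _ (- n)).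
  by rewrite /= in_itv /= xd.
by rewrite -phiB; congr phi; rewrite intrN; ring.
Qed.

(** An element a of the kernel is, for every rho > 0, an integral multiple of
    some rho / m. For rho = a * pi this would make pi rational. *)
Lemma phi_injective : ~ monothetic G -> injective phi.
Proof.
move=> nmono.
have ker a : 0 < a -> phi a <> 1%g.
  move=> a0 phia; have pi0 := pi_gt0 R.
  have rho0 : 0 < a * pi by rewrite mulr_gt0.
  have [m m0 near_m] := near_submultiple nmono rho0.
  have mR0 : 0 < (m%:R : R) by rewrite ltr0n.
  have s0 : 0 < a * pi / m%:R by rewrite divr_gt0.
  have [d d0|n an] := near_multiple_all s0 (x := a).
    have [U U1 nearU] := near_m d d0; apply: nearU; rewrite phia.
    exact: nbhs_singleton.
  have nR0 : 0 < (n%:~R : R) by rewrite -(pmulr_lgt0 _ s0) -an.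
  have n0 : 0 < n by rewrite -(ltr0z R).
  apply: (@pi_irrationnal R); apply/rationalP; exists m%:Z, `|n|%N.
  rewrite natr_absz gtr0_norm //; apply: (mulfI (lt0r_neq0 a0)).
  rewrite {2}an -!pmulrn; field.
  by rewrite !gt_eqF.
move=> x y xy; apply/eqP; rewrite -subr_eq0.
have phixy : phi (x - y) = 1%g by rewrite phiB xy mulgV.
have [xy0|xy0|//] := ltgtP (x - y) 0.
  by case: (@ker (- (x - y))); rewrite ?oppr_gt0 // phiN phixy invg1.
by case: (ker _ xy0).
Qed.

(** Multiplication by m is open on G, which removes the denominator m in
    near_submultiple: in other words, every character of the line is
    continuous for the topology of G. *)
Lemma near_multiple_phi rho d : ~ monothetic G -> nat_scaled G ->
    0 < rho -> 0 < d ->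
  exists2 U, nbhs (1%g : G) U & forall x, U (phi x) -> near_multiple rho d x.
Proof.
move=> nmono nscaled rho0 d0.
have [m m0 near_m] := near_submultiple nmono rho0.
have mR0 : 0 < (m%:R : R) by rewrite ltr0n.
have [U U1 nearU] := near_m (d / m%:R) (divr_gt0 d0 mR0).
exists [set (u ^+ m)%g | u in interior U].
  apply: open_nbhs_nbhs; split; last by exists 1%g => //; rewrite expg1n.
  by apply: nscaled => //; exact: open_interior.
move=> x [u /interior_subset Uu ux]; have [y yu] := phi_surj u.
have xy : x = m%:R * y by apply: (phi_injective nmono); rewrite phiMn yu.
have [n yn] : near_multiple (rho / m%:R) (d / m%:R) y by apply: nearU; rewrite yu.
exists n; move: yn; rewrite ltr_pdivlMr // -{2}(gtr0_norm mR0) -normrM xy.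
congr (`|_| < _); field; exact: lt0r_neq0.
Qed.

(** The Bohr topology is finer than every totally bounded group topology
    coarser than the Euclidean one. For rho small, finitely many translates of
    A = {n | phi (n rho) in W3} cover Z, by total boundedness; so by
    bogolyubov_folner a Bohr neighbourhood of 0 in Z is contained in (A - A) +
    (A - A). A real x that is close to a multiple n rho of rho, and close to
    multiples of rho / theta i for the nonzero theta i, has n in that
    neighbourhood, while the remainder x - n rho is small enough for phi to
    send it into W4. *)
Lemma bohr_nbhs_phi U : totally_bounded G -> nbhs (1%g : G) U ->
  nbhs (0 : bohr R) [set x | U (phi x)].
Proof.
move=> tb /nbhs1_split[W1 W1_1 W1U]; have [W2 W2_1 W2W1] := nbhs1_split W1_1.
have [W3 W3_1 W3W2] := nbhs1_split W2_1; have [W4 W4_1 W4W3] := nbhs1_split W3_1.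
have W41 u : W4 u -> W1 u.
  have one := nbhs_singleton W4_1.
  move=> Wu; have := (W4W3 _ _ Wu one).1; rewrite mulg1 => {}Wu.
  have one3 := nbhs_singleton W3_1.
  have := (W3W2 _ _ Wu one3).1; rewrite mulg1 => {}Wu.
  have one2 := nbhs_singleton W2_1.
  by have := (W2W1 _ _ Wu one2).1; rewrite mulg1.
have [e e0 eW4] := nbhs_phi W4_1; pose rho := e / 2.
have rho0 : 0 < rho by rewrite divr_gt0.
have rhoe : rho < e by rewrite /rho; lra.
have [F /finite_seqP[s ->] coverF] := tb _ (@open_interior G W4) W4_1.
have /choice[g gP] := phi_surj.
pose A := [set n : int | W3 (phi (n%:~R * rho))].
have [|K [theta [theta01 thetaP]]] := @bogolyubov_folner R A
    [seq Num.floor (g v / rho) | v <- s].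
  move=> n.
  have : (\bigcup_(x in [set` s]) [set (x * u)%g | u in interior W4])
      (phi (n%:~R * rho)) by rewrite coverF.
  move=> [x /= xs [u /interior_subset Wu xu]].
  exists (Num.floor (g x / rho)); first exact: map_f.
  set k := Num.floor _; rewrite /A /=.
  have /andP[h1 h2] := floor_itv (g x / rho); rewrite intrD -/k in h1 h2.
  move: h1 h2; rewrite ler_pdivlMr // ltr_pdivrMr // mulrDl mul1r => h1 h2.
  rewrite (_ : _ * rho = (g x - k%:~R * rho) + (- g x + n%:~R * rho)); last first.
    by rewrite intrB; ring.
  rewrite phiD [X in (_ * X)%g]phiD phiN gP -xu mulKg.
  apply: (W4W3 _ _ _ Wu).1; apply: eW4.
  by rewrite ger0_norm ?subr_ge0 //; lra.
have d0 : 0 < rho / 16 by rewrite divr_gt0.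
have : nbhs (0 : bohr R) [set x | near_multiple rho (rho / 16) x /\
    forall i, theta i = 0 \/ near_multiple (rho / theta i) (rho / 16) x].
  apply: filterI; first exact: near_multiple_bohr.
  apply: (@filter_forall _ _ (fun i x => theta i = 0 \/
    near_multiple (rho / theta i) (rho / 16) x) (nbhs (0 : bohr R))) => i.
  have [t0|t0] := eqVneq (theta i) 0; first by apply: nearW; left.
  have {}t0 : 0 < theta i by rewrite lt_neqAle eq_sym t0; case/andP: (theta01 i).
  apply: filterS (near_multiple_bohr (divr_gt0 rho0 t0) d0).
  by move=> x; right.
apply: filterS => x [[n xn] xtheta] /=.
have [i|a [b [c [d [[Aa Ab Ac Ad] nabcd]]]]] := thetaP n.
  have [->|[k xk]] := xtheta i; first by exists 0; rewrite mulr0 subrr normr0.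
  have /andP[t0 t1] := theta01 i.
  have [->|tn0] := eqVneq (theta i) 0.
    by exists 0; rewrite mulr0 subrr normr0.
  have {tn0}t0 : 0 < theta i by rewrite lt_neqAle eq_sym tn0.
  exists k; rewrite -(ltr_pM2r rho0) -{1}(gtr0_norm rho0) -normrM.
  have -> : (n%:~R * theta i - k%:~R) * rho =
      theta i * ((x - k%:~R * (rho / theta i)) - (x - n%:~R * rho)).
    by field; rewrite gt_eqF.
  rewrite normrM (gtr0_norm t0).
  have : `|x - k%:~R * (rho / theta i) - (x - n%:~R * rho)| < rho / 8.
    by apply: le_lt_trans (ler_normB _ _) _; lra.
  have := normr_ge0 (x - k%:~R * (rho / theta i) - (x - n%:~R * rho)).
  set z := `|_|; nra.
rewrite -(subrK (n%:~R * rho) x) phiD; apply: (W1U _ _ _ _).1.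
  by apply/W41/eW4; lra.
rewrite nabcd !intrD !mulrNz !mulrDl !mulNr phiD; apply: (W2W1 _ _ _ _).1.
  by rewrite phiB; exact: (W3W2 _ _ Aa Ab).2.
by rewrite phiB; exact: (W3W2 _ _ Ac Ad).2.
Qed.

Lemma one_parametric_bohr : totally_bounded G -> nat_scaled G -> ~ monothetic G ->
  topgroup_isomorphic G (Algebra.to_multiplicative (bohr R)).
Proof.
move=> tb nscaled nmono; have /choice[g gK] := phi_surj.
have phiK : cancel phi g by move=> x; apply: (phi_injective nmono); rewrite gK.
exists g, phi; split=> //.
- by move=> u v; apply: (phi_injective nmono); rewrite phiD !gK.
- move=> u A /nbhs_bohrD A0.
  have Fg : Filter (g @ (1%g : G)) by exact: fmap_filter.
  have : (g @ (1%g : G)) [set y | A (g u + y)].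
    apply: (cvg_bohr0 Fg _ A0) => rho d rho0 d0.
    have [U U1 UP] := near_multiple_phi nmono nscaled rho0 d0.
    by apply: filterS U1 => v Uv; apply: UP; rewrite gK.
  move=> /(@nbhs_divl _ u); apply: filterS => v /=.
  congr A; apply: (phi_injective nmono).
  by rewrite phiD !gK mulVKg.
- move=> x A /nbhs_mull/(bohr_nbhs_phi tb)/(@nbhs_bohrB _ x).
  apply: filterS => y /=; congr A.
  by rewrite -phiD; congr phi; rewrite addrC subrK.
Qed.

End OneParametric.

(** * The characterization of the Bohr line *)

Theorem theorem7p7 (R : realType) (G : topologicalGroupType)
    (G_hausdorff : hausdorff_space G) :
  topgroup_isomorphic G (Algebra.to_multiplicative (bohr R)) <->
  [/\ one_parametric R G, totally_bounded G, nat_scaled G & ~ monothetic G].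
Proof.
split=> [[f [g [fM fK gK fc gc]]]|[[phi [phiD phic phi_surj]] tb ns nm]].
  split.
  - exact: (iso_one_parametric fM fK gK gc (@bohr_one_parametric R)).
  - exact: (iso_totally_bounded fM fK gK gc (@bohr_totally_bounded R)).
  - exact: (iso_nat_scaled fM fK gK fc gc (@bohr_nat_scaled R)).
  - by move=> /(iso_monothetic fM gK fc); exact: bohr_not_monothetic.
exact: one_parametric_bohr phiD phic phi_surj tb ns nm.
Qed.
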